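(* Let $\mathbb{K}$ be a field of characteristic $0$, $R=\mathbb{K}[x_1,\dots,x_n]$, $\mathcal{S}=\mathbb{K}[x_0,\dots,x_n]$, and let $f\in\mathcal{S}_d$ have a Generalized Additive Decomposition $f=\sum_{i=1}^s\omega_i\ell_i^{d-k_i}$ with $\ell_i=x_0+\xi_{i,1}x_1+\dots+\xi_{i,n}x_n$, $\xi_i\in\mathbb{K}^n$. Let $\varphi:=\sum_{i=1}^s\omega_i^{d,\ell_i,\mathbf x}(\mathbf z)\,e_{\xi_i}(\mathbf z)\in\mathbb{K}[[z_1,\dots,z_n]]\cong R^*$, $I_\varphi:=\{p\in R: p\star\varphi=0\}$ and $\mathcal{A}_\varphi:=R/I_\varphi$. Let $B,B'\subseteq R$ be sets whose classes form bases of $\mathcal{A}_\varphi$, with $1\in B$. Let $c\le d$ and let $A\subseteq R_{\le c}$, $A'\subseteq R_{\le d-c}$ be linearly independent sets with $B^+\subseteq\langle A\rangle$ and $B'\subseteq\langle A'\rangle$, where $B^+:=B\cup x_1B\cup\dots\cup x_nB$. Let $H:=H^{A',A}_{\check f}$ be the matrix of the operator $\mathbf H:=\mathbf H^{A',A}_{\check f}$. Then: (1) $H_0:=H^{B',B}_{\check f}$ is invertible; (2) $\operatorname{rank}H=\dim\mathcal{A}_\varphi=\sum_{i=1}^s\dim\langle\omega_i\rangle^{d,\ell_i,\mathbf x}$; (3) for $1\le i\le n$, with $H_i:=H^{B',x_iB}_{\check f}$, the matrix $H_0^{-1}H_i$ is the matrix of multiplication by $x_i$ on $\mathcal{A}_\varphi$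 in the basis $B$; (4) $\ker\mathbf H=I_\varphi\cap\langle A\rangle$, the ideal generated by $\ker\mathbf H$ equals $I_\varphi$, and $\operatorname{im}\mathbf H=\{\psi|_{\langle A'\rangle}:\psi\in R^*,\ \psi(I_\varphi)=0\}$.
   Context: $R^*$ is identified with $\mathbb{K}[[\mathbf z]]=\mathbb{K}[[z_1,\dots,z_n]]$ via $\sum_\alpha\varphi_\alpha\mathbf z^\alpha/\alpha!\leftrightarrow(\mathbf x^\alpha\mapsto\varphi_\alpha)$; for $p\in R$, $p\star\varphi$ is $q\mapsto\varphi(pq)$; $e_\xi(\mathbf z)=\exp(\sum\xi_iz_i)$ (the evaluation at $\xi$). A GAD of $f\in\mathcal{S}_d$ is $f=\sum_i\omega_i\ell_i^{d-k_i}$ with $0\le k_i\le d$, $\omega_i\in\mathcal{S}_{k_i}$, $\ell_i\in\mathcal{S}_1$ pairwise non-proportional, $\ell_i\nmid\omega_i$. For $\omega\in\mathcal{S}_k$, $\ell=x_0+\sum\xi_jx_j$ and $d\ge k$: write $\omega=\sum_{j=0}^k\omega_j\ell^{k-j}$ with $\omega_j\in\mathbb{K}[x_1,\dots,x_n]_j$, set $\omega^{d,\ell,\mathbf x}:=\frac1{d!}\sum_j(d-j)!\,\omega_j\in R$ (read in the variables $\mathbf z$ when used as a series), and $\langle\omega\rangle^{d,\ell,\mathbf x}:=\operatorname{span}\{g(\partial_{x_1},\dots,\partial_{x_n})(\omega^{d,\ell,\mathbf x}):g\in R\}$. $f^*\in\mathcal{S}_d^*$ is $\frac1{d!}f(z_0,\dots,z_n)$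 (functional $\underline{\mathbf x}^\alpha\mapsto$ coefficient read via $\underline{\mathbf z}^\alpha/\alpha!$ duality), and $\check f\in R_{\le d}^*$ is $\check f(p):=f^*(x_0^dp(x_1/x_0,\dots,x_n/x_0))$. For finite sets $P,Q\subseteq R$ with $\deg(pq)\le d$ for $p\in P,q\in Q$, $H^{Q,P}_{\check f}:=(\check f(qp))_{q\in Q,p\in P}$ (rows indexed by $Q$), and $\mathbf H^{Q,P}_{\check f}:\langle P\rangle\to\langle Q\rangle^*$, $p\mapsto(q\mapsto\check f(pq))$. The matrix of multiplication by $x_i$ in basis $B=(b_j)$ has $j$-th column the coordinates of $x_ib_j$ in $\mathcal{A}_\varphi$. *)

(* Defs.v *)
From HB Require Import structures.
From mathcomp Require Import all_boot all_order all_algebra.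
From mathcomp Require Import mpoly.
Set Implicit Arguments. Unset Strict Implicit. Unset Printing Implicit Defensive.
Import Order.TTheory GRing.Theory Num.Theory.
Local Open Scope ring_scope.

Section Defs.
Variables (K : fieldType) (n : nat).
(* R = K[x_1..x_n] is {mpoly K[n]} ('X_i for i : 'I_n is x_{i+1});
   S = K[x_0..x_n] is {mpoly K[n.+1]} ('X_ord0 is x_0, 'X_(lift ord0 i) is x_{i+1}). *)
Local Notation R := {mpoly K[n]}.
Local Notation S := {mpoly K[n.+1]}.

Definition liftR (p : R) : S :=
  mmap (fun c : K => c%:MP) (fun i : 'I_n => 'X_(lift ord0 i)) p.

Definition linform (xi : 'I_n -> K) : S :=
  'X_ord0 + \sum_(j < n) xi j *: 'X_(lift ord0 j).

Definition degle (c : nat) (p : R) : bool := (msize p <= c.+1)%N.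

Definition mfact (m : nat) (a : 'X_{1..m}) : nat := (\prod_(i < m) (a i)`!)%N.

Definition monpow (xi : 'I_n -> K) (a : 'X_{1..n}) : K := \prod_(i < n) xi i ^+ a i.

Definition diffop (g q : R) : R := \sum_(m <- msupp g) g@_m *: q^`M[m].

(* <omega>^{d,l,x} = span { g(partial)(q) : g in R } (already a subspace) *)
Definition deriv_span (q : R) (v : R) : Prop := exists g : R, v = diffop g q.

Definition omega_dehom (d : nat) (w : nat -> R) (k : nat) : R :=
  (d`!%:R)^-1 *: \sum_(j < k.+1) ((d - j)`!)%:R *: w j.

(* coefficient of z^alpha in the power series q(z) * e_xi(z) *)
Definition coef_qexp (q : R) (xi : 'I_n -> K) (a : 'X_{1..n}) : K :=
  \sum_(b <- msupp q | (b <= a)%MM)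
     q@_b * monpow xi (a - b)%MM / (mfact (a - b)%MM)%:R.

(* The functional phi in R^* associated with the series
   sum_i qs_i(z) e_{xi_i}(z) = sum_alpha phi_alpha z^alpha / alpha!,
   i.e. phi(x^alpha) = phi_alpha = alpha! [z^alpha](series), extended linearly. *)
Definition phi_mon (s : nat) (qs : 'I_s -> R) (xis : 'I_s -> 'I_n -> K)
  (a : 'X_{1..n}) : K :=
  (mfact a)%:R * \sum_(i < s) coef_qexp (qs i) (xis i) a.

Definition phi (s : nat) (qs : 'I_s -> R) (xis : 'I_s -> 'I_n -> K) (p : R) : K :=
  \sum_(a <- msupp p) p@_a * phi_mon qs xis a.

(* p \in I_phi  <->  p * phi = 0, i.e. q |-> phi(p q) is zero *)
Definition annih (ph : R -> K) (p : R) : Prop := forall q : R, ph (p * q) = 0.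

(* f^* in S_d^*: f^*(x^alpha) = alpha! f_alpha / d!  (f^* = f(z)/d!) *)
Definition fstar (d : nat) (f : S) (g : S) : K :=
  \sum_(m <- msupp g) g@_m * ((mfact m)%:R * f@_m / (d`!)%:R).

(* x_0^d p(x_1/x_0, ..., x_n/x_0) for deg p <= d *)
Definition homogenize (d : nat) (p : R) : S :=
  \sum_(m <- msupp p) p@_m *: ('X_ord0 ^+ (d - mdeg m) * liftR 'X_[m]).

Definition fcheck (d : nat) (f : S) (p : R) : K := fstar d f (homogenize d p).

Definition hankel (d : nat) (f : S) (a b : nat) (Q : 'I_a -> R) (P : 'I_b -> R)
  : 'M[K]_(a, b) := \matrix_(i < a, j < b) fcheck d f (Q i * P j).

Definition inspan (a : nat) (A : 'I_a -> R) (p : R) : Prop :=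
  exists c : 'I_a -> K, p = \sum_(j < a) c j *: A j.

Definition linindep (a : nat) (A : 'I_a -> R) : Prop :=
  forall c : 'I_a -> K, \sum_(j < a) c j *: A j = 0 -> forall j, c j = 0.

Definition quot_basis (ph : R -> K) (r : nat) (B : 'I_r -> R) : Prop :=
  (forall c : 'I_r -> K, annih ph (\sum_(j < r) c j *: B j) -> forall j, c j = 0)
  /\ (forall p : R, exists c : 'I_r -> K, annih ph (p - \sum_(j < r) c j *: B j)).

Definition is_basis_of (P : R -> Prop) (bs : seq R) : Prop :=
  (forall j : 'I_(size bs), P (bs`_j))
  /\ (forall c : 'I_(size bs) -> K,
        \sum_(j < size bs) c j *: bs`_j = 0 -> forall j, c j = 0)
  /\ (forall v, P v -> exists c : 'I_(size bs) -> K,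
        v = \sum_(j < size bs) c j *: bs`_j).

Definition hker (d : nat) (f : S) (a a' : nat) (A : 'I_a -> R) (A' : 'I_a' -> R)
  (p : R) : Prop :=
  inspan A p /\ forall q, inspan A' q -> fcheck d f (p * q) = 0.

End Defs.

(* Main.v *)
(** Write [q_i] for the dehomogenized [omega_i].  Translating by [xi_i], the
    functional [phi] becomes [p |-> \sum_i (p(xi_i + grad) q_i)(0)], and it agrees
    with [fcheck] up to degree [d].  Since the [xi_i] are distinct, there are
    polynomials acting as the identity on [q_i] and as zero on the other [q_j];
    hence [I_phi] is the common annihilator of the [q_i] and [R / I_phi] is the
    direct sum of the spaces of derivatives of the [q_i].  The remaining claims
    are linear algebra for the form [(p, q) |-> phi (p q)], which is
    nondegenerate on [R / I_phi]; the ideal generated by the kernel is all of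
    [I_phi] because modulo it the span of [B] contains [1] and is stable under
    the variables. *)
Require Import Defs.
From HB Require Import structures.
From mathcomp Require Import all_boot all_order all_algebra.
From mathcomp Require Import bigenough ssrcomplements mpoly ring.
Import Order.TTheory GRing.Theory Num.Theory BigEnough.
Local Open Scope ring_scope.

(** * Linear extension of maps given on monomials *)

Section LinearExtension.
Set Implicit Arguments.
Unset Strict Implicit.
Variables (K : fieldType) (n : nat) (V : lmodType K).
Local Notation R := {mpoly K[n]}.
Implicit Types (F : 'X_{1..n} -> V) (p q : R).

Definition lext F p : V := \sum_(m <- msupp p) p@_m *: F m.

(** A common degree bound replaces the varying supports by one finite index set, so sums attached to
    different polynomials can be compared termwise. *)
Lemma lextwE N F p : (msize p <= N)%N ->
  lext F p = \sum_(m : 'X_{1..n < N}) p@_m *: F m.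
Proof.
move=> leN; pose I : subFinType _ := 'X_{1..n < N}.
rewrite /lext (big_mksub I) ?msupp_uniq //=; first last.
  by move=> m /msize_mdeg_lt /leq_trans; apply.
rewrite big_rmcond //= => m; rewrite -mcoeff_eq0 => /eqP ->.
by rewrite scale0r.
Qed.

Lemma lextP F c p q : lext F (c *: p + q) = c *: lext F p + lext F q.
Proof.
pose_big_enough N.
  rewrite !(@lextwE N) // scaler_sumr -big_split /=.
  by apply: eq_bigr => m _; rewrite mcoeffD mcoeffZ scalerDl scalerA.
by close.
Qed.

HB.instance Definition _ F := GRing.isLinear.Build K R V _ (lext F) (lextP F).

Lemma lextX F m : lext F 'X_[m] = F m.
Proof. by rewrite /lext msuppX big_seq1 mcoeffX eqxx scale1r. Qed.

Lemma mpoly_linear_ext (L1 L2 : R -> V) :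
    (forall c p q, L1 (c *: p + q) = c *: L1 p + L1 q) ->
    (forall c p q, L2 (c *: p + q) = c *: L2 p + L2 q) ->
  (forall m, L1 'X_[m] = L2 'X_[m]) -> L1 =1 L2.
Proof.
move=> l1 l2 eqX; elim/mpolyind => [|c m p _ _ IHp].
  by have := l1 (-1) 0 0; have := l2 (-1) 0 0;
    rewrite scaler0 addr0 !scaleN1r !addNr => -> ->.
by rewrite l1 l2 eqX IHp.
Qed.

End LinearExtension.

(** * Constant-coefficient differential operators, translations and the functional [phi] *)

Section Apolarity.
Set Implicit Arguments.
Unset Strict Implicit.
Variables (K : fieldType) (n : nat).
Local Notation R := {mpoly K[n]}.
Implicit Types (p q g h : R) (xi : 'I_n -> K) (a b m : 'X_{1..n}).

Lemma diffopE g q : diffop g q = lext (fun m => q^`M[m]) g.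
Proof. by []. Qed.

Lemma diffopP c g h q : diffop (c *: g + h) q = c *: diffop g q + diffop h q.
Proof. by rewrite !diffopE linearP. Qed.

Lemma diffop_linear g c p q :
  diffop g (c *: p + q) = c *: diffop g p + diffop g q.
Proof.
rewrite /diffop scaler_sumr -big_split /=; apply: eq_bigr => m _.
by rewrite linearP scalerDr !scalerA mulrC.
Qed.

Lemma diffopX m q : diffop 'X_[m] q = q^`M[m].
Proof. by rewrite diffopE lextX. Qed.

Lemma diffop1 q : diffop 1 q = q.
Proof. by rewrite -mpolyX0 diffopX mderivm0m. Qed.

Lemma diffop0 q : diffop 0 q = 0.
Proof. by rewrite diffopE linear0. Qed.

Lemma diffop0r g : diffop g 0 = 0.
Proof. by rewrite /diffop big1 // => m _; rewrite linear0 scaler0. Qed.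

Lemma diffopB g h q : diffop (g - h) q = diffop g q - diffop h q.
Proof. by rewrite !diffopE linearB. Qed.

Lemma diffop_sum (I : finType) (c : I -> K) (g : I -> R) q :
  diffop (\sum_i c i *: g i) q = \sum_i c i *: diffop (g i) q.
Proof.
rewrite diffopE linear_sum; apply: eq_bigr => i _.
by rewrite linearZ.
Qed.

(** Partial derivatives commute, so [diffop] is a module action of [R]; bilinearity in [g] and [h]
    reduces this to monomials. *)
Lemma diffopM g h q : diffop (g * h) q = diffop g (diffop h q).
Proof.
move: g; apply: mpoly_linear_ext => [c g1 g2|c g1 g2|m].
- by rewrite mulrDl -scalerAl diffopP.
- by rewrite diffopP.
move: h; apply: mpoly_linear_ext => [c h1 h2|c h1 h2|b].
- by rewrite mulrDr -scalerAr diffopP.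
- by rewrite diffopP diffop_linear.
by rewrite -mpolyXD !diffopX addmC mderivmDm.
Qed.

Lemma mderivm_coef0 q m : (q^`M[m])@_0%MM = (mfact m)%:R * q@_m.
Proof.
rewrite mcoeff_mderivm addm0 mulr_natl; congr (_ *+ _).
by apply: eq_bigr => i _; rewrite ffactnn.
Qed.

(** This is the apolar pairing: only monomials common to [g] and [q] contribute, so the sum may run
    over either support. *)
Lemma diffop_coef0 g q :
  (diffop g q)@_0%MM = \sum_(b <- msupp q) q@_b * ((mfact b)%:R * g@_b).
Proof.
have -> : \sum_(b <- msupp q) q@_b * ((mfact b)%:R * g@_b)
  = lext (fun b => (mfact b)%:R * g@_b : K^o) q by [].
rewrite diffopE; pose_big_enough N.
  rewrite !(@lextwE _ _ _ N) // linear_sum /=; apply: eq_bigr => m _.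
  by rewrite mcoeffZ mderivm_coef0 [RHS]mulrC -mulrA mulrCA [_ * q@_m]mulrC.
by close.
Qed.

Lemma mfact_neq0 m : [pchar K] =i pred0 -> (mfact m)%:R != 0 :> K.
Proof.
move=> /pcharf0P charK; rewrite charK -lt0n prodn_gt0 // => i.
exact: fact_gt0.
Qed.

(** The test operator ['X_[m]] isolates [m!] times the coefficient at [m], and [m!] is invertible in
    characteristic 0. *)
Lemma diffop_nondeg q : [pchar K] =i pred0 ->
  (forall g, (diffop g q)@_0%MM = 0) -> q = 0.
Proof.
move=> charK q0; apply/mpolyP => m; apply/eqP.
have := q0 'X_[m]; rewrite diffopX mderivm_coef0 => /eqP.
by rewrite mulf_eq0 (negPf (mfact_neq0 m charK)) mcoeff0.
Qed.

Lemma diffop_Xn_eq0 i N q : (msize q <= N)%N -> diffop ('X_i ^+ N) q = 0.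
Proof.
move=> leN; rewrite mpolyXn diffopX; apply/mpolyP => m.
rewrite mcoeff_mderivm mcoeff0 memN_msupp_eq0 ?mul0rn //.
apply: msize_mdeg_ge; rewrite mdegD mdegMn mdeg1 mul1n.
exact: leq_trans (leq_addr _ _).
Qed.

(** Translation of the argument by [xi]. It serves the rule p(grad)(q e_xi) = (p(xi + grad) q) e_xi,
    which trades exponential series for polynomials. *)
Definition shift xi p : R := p \mPo [tuple 'X_i + (xi i)%:MP | i < n].

HB.instance Definition _ xi := GRing.RMorphism.copy (shift xi)
  (comp_mpoly [tuple 'X_i + (xi i)%:MP | i < n]).

Lemma shiftP xi c p q : shift xi (c *: p + q) = c *: shift xi p + shift xi q.
Proof. by rewrite /shift linearP. Qed.

Lemma shiftZ xi c p : shift xi (c *: p) = c *: shift xi p.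
Proof. by rewrite /shift linearZ. Qed.

Lemma shift_sum xi (I : finType) (c : I -> K) (g : I -> R) :
  shift xi (\sum_i c i *: g i) = \sum_i c i *: shift xi (g i).
Proof. by rewrite /shift linear_sum; apply: eq_bigr => i _; rewrite linearZ. Qed.

Lemma shiftXU xi i : shift xi 'X_i = 'X_i + (xi i)%:MP.
Proof. by rewrite /shift comp_mpolyXU -tnth_nth tnth_mktuple. Qed.

Lemma shiftC xi c : shift xi c%:MP = c%:MP.
Proof. exact: comp_mpolyC. Qed.

Lemma mnm_ind (P : 'X_{1..n} -> Prop) :
  P 0%MM -> (forall i m, P m -> P (U_(i) + m)%MM) -> forall m, P m.
Proof.
move=> P0 PD m; have [k] := ubnP (mdeg m).
elim: k m => // k IHk m; rewrite ltnS => lemk.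
have [m0|/eqP] := eqVneq (mdeg m) 0%N.
  by move/eqP: m0; rewrite mdeg_eq0 => /eqP ->.
rewrite mdegE => /eqP; rewrite sum_nat_eq0 negb_forall => /existsP[i /= mi].
have leUm : (U_(i) <= m)%MM by rewrite lep1mP.
rewrite -(submK leUm) addmC; apply/PD/IHk.
by move: lemk; rewrite -{1}(submK leUm) mdegD mdeg1 addn1.
Qed.

Lemma shiftK xi p : shift xi (shift (fun i => - xi i) p) = p.
Proof.
move: p; apply: mpoly_linear_ext => [c p q|//|].
- by rewrite !shiftP.
elim/mnm_ind => [|i m IHm]; first by rewrite mpolyX0 !rmorph1.
rewrite mpolyXD !rmorphM /= IHm shiftXU rmorphD /= shiftXU shiftC.
by rewrite mpolyCN addrK.
Qed.

Lemma mderivXU i j : ('X_j : R)^`M(i) = (j == i)%:R%:MP.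
Proof.
rewrite mderivX mnm1E; have [->|_] := eqVneq j i; last first.
  by rewrite scale0r mpolyC0.
rewrite scale1r mpolyC1 -mpolyX0; congr 'X_[_].
by apply/mnmP => l; rewrite mnmBE subnn mnm0E.
Qed.

Lemma mderiv_shift xi i p : (shift xi p)^`M(i) = shift xi p^`M(i).
Proof.
move: p; apply: mpoly_linear_ext => [c p q|c p q|].
- by rewrite shiftP linearP.
- by rewrite linearP shiftP.
elim/mnm_ind => [|j m IHm].
  by rewrite mpolyX0 rmorph1 -mpolyC1 mderivC rmorph0.
rewrite mpolyXD rmorphM /= !mderivM rmorphD !rmorphM /= IHm; congr (_ * _ + _).
by rewrite shiftXU mderivD mderivC addr0 mderivXU shiftC.
Qed.

Lemma mderivm_shift xi m p : (shift xi p)^`M[m] = shift xi p^`M[m].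
Proof.
rewrite !mderivm_foldr; elim: (flatten _) => //= i t ->.
exact: mderiv_shift.
Qed.

Lemma shift_coef0 xi m : (shift xi 'X_[m])@_0%MM = monpow xi m.
Proof.
rewrite /shift comp_mpolyX rmorph_prod /=; apply: eq_bigr => i _.
rewrite rmorphXn /= tnth_mktuple mcoeffD mcoeffC eqxx mulr1 mcoeffX.
by rewrite mnm1_eq0 add0r.
Qed.

(** Taylor's formula at [xi]: differentiation commutes with translation and sends x^a to a!/(a-b)!
    x^(a-b), which is then evaluated at [xi]. *)
Lemma shift_coef xi a b : [pchar K] =i pred0 ->
  (mfact b)%:R * (shift xi 'X_[a])@_b =
  if (b <= a)%MM
  then (mfact a)%:R * (monpow xi (a - b)%MM / (mfact (a - b)%MM)%:R) else 0.
Proof.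
move=> charK; rewrite -mderivm_coef0 mderivm_shift mderivmX shiftZ mcoeffZ.
rewrite shift_coef0; case: ifPn => [/mnm_lepP leba|].
  have -> : (mfact a)%:R
      = (\prod_(i < n) (a i)^_(b i))%:R * (mfact (a - b)%MM)%:R :> K.
    rewrite -natrM; congr _%:R; rewrite /mfact -big_split /=.
    by apply: eq_bigr => i _; rewrite mnmBE ffact_fact.
  by rewrite -mulrA [_ * (_ / _)]mulrC divfK // mfact_neq0.
(* Some [a i < b i], so one falling factorial in the product vanishes. *)
rewrite /lem negb_forall => /existsP[i]; rewrite -ltnNge => ltab.
by rewrite (bigD1 i) //= ffact_small // mul0n mul0r.
Qed.

Lemma diffop_shift_coef0 xi q a : [pchar K] =i pred0 ->
  (diffop (shift xi 'X_[a]) q)@_0%MM = (mfact a)%:R * coef_qexp q xi a.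
Proof.
move=> charK; rewrite diffop_coef0 /coef_qexp mulr_sumr [RHS]big_mkcond /=.
apply: eq_bigr => b _; rewrite shift_coef //; case: ifP => _; last exact: mulr0.
by rewrite mulrCA -!mulrA.
Qed.

(** By linearity it suffices to take p = x^a; the constant term of (xi + grad)^a q is then a! times
    the coefficient of z^a in q e_xi. *)
Lemma phiE s (qs : 'I_s -> R) (xis : 'I_s -> 'I_n -> K) p :
    [pchar K] =i pred0 ->
  phi qs xis p = \sum_(i < s) (diffop (shift (xis i) p) (qs i))@_0%MM.
Proof.
move=> charK.
have -> : phi qs xis p = lext (phi_mon qs xis : _ -> K^o) p by [].
move: p; apply: (@mpoly_linear_ext K n K^o) => [c p q|c p q|m].
- exact: linearP.
- rewrite scaler_sumr -big_split /=; apply: eq_bigr => i _.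
  by rewrite shiftP diffopP mcoeffD mcoeffZ.
rewrite lextX /phi_mon mulr_sumr; apply: eq_bigr => i _.
by rewrite diffop_shift_coef0.
Qed.

Lemma phiP s (qs : 'I_s -> R) (xis : 'I_s -> 'I_n -> K) c p q :
  phi qs xis (c *: p + q) = c * phi qs xis p + phi qs xis q.
Proof. exact: (lextP (phi_mon qs xis : _ -> K^o)). Qed.

End Apolarity.

(** * Coefficients of homogeneous forms, and agreement of [fcheck] with [phi] up to degree [d] *)

Section Dehomogenization.
Set Implicit Arguments.
Unset Strict Implicit.
Variables (K : fieldType) (n : nat).
Local Notation R := {mpoly K[n]}.
Local Notation S := {mpoly K[n.+1]}.
Hypothesis charK : [pchar K] =i pred0.
Implicit Types (p q : R) (xi : 'I_n -> K) (m b : 'X_{1..n}).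

(* Multinomial formula, by comparing coefficients of one partial derivative. *)
Lemma linpow_coef k (c : 'I_k -> K) N (m : 'X_{1..k}) : mdeg m = N ->
  (mfact m)%:R * ((\sum_i c i *: 'X_i) ^+ N)@_m = N`!%:R * monpow c m.
Proof.
set l := \sum_i _; elim: N m => [|N IHN] m.
  move=> /eqP; rewrite mdeg_eq0 => /eqP ->.
  rewrite expr0 -mpolyC1 mcoeffC eqxx /mfact /monpow !big1 ?mulr1 // => i _.
    by rewrite mnm0E.
  by rewrite mnm0E.
move=> degm; have /existsP[i mi] : [exists i, m i != 0%N].
  rewrite -negb_forall -(sum_nat_eq0 (fun=> true) m) -mdegE degm //.
have leUm : (U_(i) <= m)%MM by rewrite lep1mP.
rewrite -(submK leUm) in degm *; set m' := (m - _)%MM in degm *.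
have /IHN IH : mdeg m' = N by apply/eqP; rewrite -eqSS -degm mdegD mdeg1 addn1.
have dl : l^`M(i) = (c i)%:MP.
  rewrite linear_sum /= (bigD1 i) //= big1 => [|j ji]; last first.
    by rewrite linearZ /= mderivXU (negPf ji) mpolyC0 scaler0.
  by rewrite addr0 linearZ /= mderivXU eqxx -mul_mpolyC mpolyC1 mulr1.
have dlX M : (l ^+ M.+1)^`M(i) = (M.+1%:R * c i) *: l ^+ M.
  elim: M => [|M IHM]; first by rewrite expr1 dl mul1r expr0 -mul_mpolyC mulr1.
  rewrite exprS mderivM dl IHM -scalerAr -exprS mul_mpolyC -scalerDl.
  by rewrite -[M.+2]addn1 natrD mulrDl mul1r addrC.
have := congr1 (mcoeff m') (dlX N); rewrite mcoeff_deriv mcoeffZ => dc.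
have -> : mfact (m' + U_(i))%MM = ((m' i).+1 * mfact m')%N.
  rewrite /mfact (bigD1 i) // [in RHS](bigD1 i) //= mnmDE mnm1E eqxx addn1 factS mulnA.
  congr (_ * _)%N; apply: eq_bigr => j ji.
  by rewrite mnmDE mnm1E eq_sym (negPf ji) addn0.
have -> : monpow c (m' + U_(i))%MM = c i * monpow c m'.
  rewrite /monpow (bigD1 i) // [in RHS](bigD1 i) //= mnmDE mnm1E eqxx addn1 exprS mulrA.
  congr (_ * _); apply: eq_bigr => j ji.
  by rewrite mnmDE mnm1E eq_sym (negPf ji) addn0.
rewrite natrM [_%:R * _]mulrC -mulrA [_%:R * _@__]mulr_natl dc.
by rewrite mulrCA IH factS natrM -!mulrA; congr (_ * _); rewrite mulrCA.
Qed.

(** The exponent of x_0^k x^m; with [k = d - mdeg m] it is that of the degree [d] homogenization of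
    x^m. *)
Definition mcons k m : 'X_{1..n.+1} :=
  [multinom oapp m k (unlift ord0 i) | i < n.+1].

Lemma mcons0 k m : mcons k m ord0 = k.
Proof. by rewrite mnmE unlift_none. Qed.

Lemma mconsS k m j : mcons k m (lift ord0 j) = m j.
Proof. by rewrite mnmE liftK. Qed.

Lemma mdeg_mcons k m : mdeg (mcons k m) = (k + mdeg m)%N.
Proof.
rewrite !mdegE big_ord_recl mcons0; congr addn.
by apply: eq_bigr => i _; rewrite mconsS.
Qed.

Lemma mfact_mcons k m : mfact (mcons k m) = (k`! * mfact m)%N.
Proof.
rewrite /mfact big_ord_recl mcons0; congr muln.
by apply: eq_bigr => i _; rewrite mconsS.
Qed.

Lemma mcons_le b k m : (mcons 0 b <= mcons k m)%MM = (b <= m)%MM.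
Proof.
apply/mnm_lepP/mnm_lepP => le i; first by have := le (lift ord0 i); rewrite !mconsS.
by have [j ->|->] := unliftP ord0 i; rewrite ?mconsS ?mcons0.
Qed.

Lemma mconsD k b m : (mcons 0 b + mcons k m = mcons k (b + m))%MM.
Proof.
apply/mnmP => i; rewrite mnmDE.
by have [j ->|->] := unliftP ord0 i; rewrite ?mconsS ?mcons0 ?mnmDE.
Qed.

Lemma X0_liftRX k m : 'X_ord0 ^+ k * liftR ('X_[m] : R) = 'X_[mcons k m] :> S.
Proof.
rewrite /liftR mmapX /mmap1 [RHS]mpolyXE_id big_ord_recl mcons0; congr (_ * _).
by apply: eq_bigr => i _; rewrite mconsS.
Qed.

Lemma liftRE p : liftR p = \sum_(m <- msupp p) p@_m *: 'X_[mcons 0 m].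
Proof.
apply: eq_bigr => m _; rewrite mul_mpolyC -X0_liftRX expr0 mul1r.
by rewrite /liftR mmapX.
Qed.

(** Treating 1 as the coefficient of x_0 brings the form into the shape of the multinomial
    formula. *)
Lemma linformE xi :
  linform xi = \sum_i oapp xi 1 (unlift ord0 i) *: 'X_i.
Proof.
rewrite /linform big_ord_recl unlift_none scale1r; congr (_ + _).
by apply: eq_bigr => i _; rewrite liftK.
Qed.

Lemma monpow_mcons xi k m :
  monpow (fun i => oapp xi 1 (unlift ord0 i)) (mcons k m) = monpow xi m.
Proof.
rewrite /monpow big_ord_recl mcons0 unlift_none expr1n mul1r.
by apply: eq_bigr => i _; rewrite mconsS liftK.
Qed.

Lemma mcoeffXM_notle k (u v : 'X_{1..k}) (p : {mpoly K[k]}) :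
  ~~ (u <= v)%MM -> ('X_[u] * p)@_v = 0.
Proof.
move=> nle; apply: memN_msupp_eq0; apply: contra nle.
rewrite mulrC (perm_mem (msuppMX _ _)) => /mapP[t _ ->]; exact: lem_addr.
Qed.

(** A monomial x^b of [w] contributes the coefficient of the linear power at x_0^(d-|m|) x^(m-b),
    known from the multinomial formula. The factor (d-|m|)! occurs on both sides of that formula's
    use, and x_0 has coefficient 1, so only data in x_1, ..., x_n remain. *)
Lemma liftR_linpow_coef (w : R) xi j d m :
    w \is j.-homog -> (j <= d)%N -> (mdeg m <= d)%N ->
  (mfact (mcons (d - mdeg m) m))%:R *
     (liftR w * linform xi ^+ (d - j))@_(mcons (d - mdeg m) m) =
  (d - j)`!%:R * ((mfact m)%:R * coef_qexp w xi m).
Proof.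
move=> /dhomogP w_hom lejd lemd; rewrite liftRE mulr_suml linear_sum /=.
rewrite /coef_qexp [X in _ = _ * (_ * X)]big_mkcond !mulr_sumr /=.
apply: eq_big_seq => b /w_hom degb.
rewrite -scalerAl mcoeffZ; case: ifPn => lebm; last first.
  by rewrite mcoeffXM_notle ?mcons_le // !mulr0.
move: (m - b)%MM (submK lebm) => t mE.
have -> k (p : S) : ('X_[mcons 0 b] * p)@_(mcons k m) = p@_(mcons k t).
  by rewrite -mE addmC -mconsD mulrC mcoeffMX.
have := @linpow_coef _ (fun i => oapp xi 1 (unlift ord0 i)) (d - j)
  (mcons (d - mdeg m) t).
rewrite -linformE monpow_mcons !mfact_mcons !natrM => lc.
have t_neq0 := mfact_neq0 t charK.
(* Homogeneity of [w] gives |b| = j, hence |t| = |m| - j, the total degree the multinomial formula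
   requires. *)
have degt : mdeg (mcons (d - mdeg m) t) = (d - j)%N.
  rewrite mdeg_mcons; move: (congr1 (@mdeg _) mE) lemd; rewrite mdegD degb => <- le.
  by rewrite addnC (addnBA _ le) subnDl.
move/lc: degt => {}lc.
set L := _@__ in lc *; set k := (_`!)%:R in lc *; set M := monpow _ _ in lc *.
move: (mfact m)%:R (mfact t)%:R w@_b ((d - j)`!)%:R t_neq0 lc => a T c D T0 lc.
transitivity (a * c * (k * T * L) / T); first by field.
by rewrite lc; field.
Qed.

Lemma coef_qexpP xi m c p q :
  coef_qexp (c *: p + q) xi m = c * coef_qexp p xi m + coef_qexp q xi m.
Proof.
pose F b : K^o := if (b <= m)%MM
  then monpow xi (m - b)%MM / (mfact (m - b)%MM)%:R else 0.
have E g : coef_qexp g xi m = lext F g.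
  rewrite /coef_qexp big_mkcond; apply: eq_bigr => b _; rewrite /F.
  by case: ifP => _; rewrite ?scaler0 // -mulrA.
by rewrite !E lextP.
Qed.

Lemma coef_qexp0 xi m : coef_qexp (0 : R) xi m = 0.
Proof. by rewrite /coef_qexp msupp0 big_nil. Qed.

Lemma coef_qexp_sum xi m k (c : 'I_k -> K) (w : 'I_k -> R) :
  coef_qexp (\sum_i c i *: w i) xi m = \sum_i c i * coef_qexp (w i) xi m.
Proof.
elim/big_rec2: _ => [|i x y _ IH]; first exact: coef_qexp0.
by rewrite coef_qexpP IH.
Qed.

Lemma coef_omega_dehom xi m d (w : nat -> R) k :
  coef_qexp (omega_dehom d w k) xi m =
  (\sum_(j < k.+1) (d - j)`!%:R * coef_qexp (w j) xi m) / d`!%:R.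
Proof.
rewrite /omega_dehom -[X in coef_qexp X]addr0 coef_qexpP.
by rewrite coef_qexp0 addr0 coef_qexp_sum mulrC.
Qed.

Lemma fcheckX d (f : S) m :
  fcheck d f 'X_[m] =
  (mfact (mcons (d - mdeg m) m))%:R * f@_(mcons (d - mdeg m) m) / d`!%:R.
Proof.
rewrite /fcheck /homogenize msuppX big_seq1 mcoeffX eqxx scale1r X0_liftRX.
by rewrite /fstar msuppX big_seq1 mcoeffX eqxx mul1r.
Qed.

Lemma fcheckP d (f : S) c p q :
  fcheck d f (c *: p + q) = c * fcheck d f p + fcheck d f q.
Proof.
pose F (m : 'X_{1..n.+1}) : K^o := (mfact m)%:R * f@_m / d`!%:R.
have E g : fcheck d f g = lext F
    (lext (fun m => 'X_ord0 ^+ (d - mdeg m) * liftR ('X_[m] : R)) g) by [].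
by rewrite !E !lextP.
Qed.

(** Each summand of the decomposition re-expands as the sum over j of w_j l^(d-j). Its coefficients
    carry the factors (d-j)!, and [fcheck] divides by d!: exactly the weights in [omega_dehom]. *)
Lemma fcheck_phi d s (om : 'I_s -> S) (k : 'I_s -> nat) (xi : 'I_s -> 'I_n -> K)
    (w : 'I_s -> nat -> R) p :
    (forall i, (k i <= d)%N) ->
    (forall i j, (j <= k i)%N -> w i j \is j.-homog) ->
    (forall i, om i =
       \sum_(j < (k i).+1) liftR (w i j) * linform (xi i) ^+ (k i - j)) ->
    degle d p ->
  fcheck d (\sum_(i < s) om i * linform (xi i) ^+ (d - k i)) p =
  phi (fun i => omega_dehom d (w i) (k i)) xi p.
Proof.
move=> k_le w_hom om_dec degp; set f := \sum_(i < s) _.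
have EX m : (mdeg m <= d)%N -> fcheck d f 'X_[m] =
    phi_mon (fun i => omega_dehom d (w i) (k i)) xi m.
  move=> lemd; rewrite fcheckX /phi_mon /f raddf_sum mulr_sumr /=.
  rewrite mulr_suml mulr_sumr; apply: eq_bigr => i _.
  have -> : om i * linform (xi i) ^+ (d - k i) =
      \sum_(j < (k i).+1) liftR (w i j) * linform (xi i) ^+ (d - j).
    rewrite om_dec mulr_suml; apply: eq_bigr => j _.
    by rewrite -mulrA -exprD addnC addnBA ?subnK // -ltnS.
  rewrite coef_omega_dehom mulrA raddf_sum !mulr_sumr; congr (_ / _).
  apply: eq_bigr => j _; have lej : (j <= k i)%N by rewrite -ltnS.
  rewrite liftR_linpow_coef ?w_hom //; last exact: leq_trans (k_le i).
  by rewrite mulrCA.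
(* Expanding over the support of [p] leaves only monomials of degree at most [d], where [EX]
   applies. *)
pose L m : K^o := fcheck d f 'X_[m].
have -> : fcheck d f p = lext L p.
  apply: (@mpoly_linear_ext K n K^o) => [c g h|c g h|m].
  - exact: fcheckP.
  - exact: linearP.
  - by rewrite lextX.
apply: eq_big_seq => m mp; rewrite /L EX // -ltnS.
exact: leq_trans (msize_mdeg_lt mp) degp.
Qed.

End Dehomogenization.

(** * Bases extracted from finite families, and dimension counts modulo a subspace *)

Section Dimension.
Set Implicit Arguments.
Unset Strict Implicit.
Variables (K : fieldType) (n : nat).
Local Notation R := {mpoly K[n]}.
Implicit Types (p q g : R).

(** The basis is read off a maximal free set of rows of the coefficient matrix of the family. *)
Lemma basis_of_family r (v : 'I_r -> R) :
  exists bs : seq R,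
    [/\ forall j : 'I_(size bs), exists k, bs`_j = v k,
        forall c : 'I_(size bs) -> K, \sum_j c j *: bs`_j = 0 -> forall j, c j = 0
      & forall k, exists c : 'I_(size bs) -> K, v k = \sum_j c j *: bs`_j].
Proof.
pose N := (\max_(j < r) msize (v j))%N.
have leN j : (msize (v j) <= N)%N by exact: (leq_bigmax j).
pose M := \matrix_(j < r, l < #|{: 'X_{1..n < N}}|) (v j)@_(enum_val l).
(* Below the common degree bound a polynomial is determined by its coefficient row, so linear
   combinations become matrix products. *)
have rowE k (c : 'I_k -> K) (h : 'I_k -> 'I_r) (x : R) :
    (msize x <= N)%N ->
    x = \sum_j c j *: v (h j) <->
    \row_(l < #|{: 'X_{1..n < N}}|) x@_(enum_val l) = (\row_j c j) *m rowsub h M.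
  move=> lex; split => [->|eqx].
    apply/rowP => l; rewrite !mxE raddf_sum; apply: eq_bigr => j _.
    by rewrite /= mcoeffZ !mxE.
  apply/mpolyP => m; have [ltm|lem] := ltnP (mdeg m) N; last first.
    have out (y : R) : (msize y <= N)%N -> y@_m = 0.
      by move=> ley; apply/memN_msupp_eq0/msize_mdeg_ge/(leq_trans ley).
    by rewrite raddf_sum big1 ?out // => j _; rewrite /= mcoeffZ out ?mulr0.
  have /rowP/(_ (enum_rank (BMultinom ltm))) := eqx.
  rewrite !mxE enum_rankK /= => ->; rewrite raddf_sum; apply: eq_bigr => j _.
  by rewrite /= mcoeffZ !mxE enum_rankK.
pose h := maxrankfun M; pose bs := [seq v (h j) | j : 'I_(\rank M)].
have szbs : size bs = \rank M by rewrite size_map -cardE card_ord.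
have bsE (j : 'I_(size bs)) : bs`_j = v (h (cast_ord szbs j)).
  rewrite (nth_map (cast_ord szbs j)) ?size_enum_ord -?szbs //.
  by congr (v (h _)); apply: val_inj; rewrite /= nth_enum_ord // -szbs.
have sumE (c : 'I_(size bs) -> K) : \sum_j c j *: bs`_j
    = \sum_(j < \rank M) c (cast_ord (esym szbs) j) *: v (h j).
  rewrite (reindex (cast_ord (esym szbs))); last first.
    by exists (cast_ord szbs) => j _; rewrite ?cast_ordK ?cast_ordKV.
  apply: eq_bigr => j _; rewrite bsE; congr (_ *: v (h _)).
  exact: val_inj.
exists bs; split=> [j|c|k].
- by exists (h (cast_ord szbs j)).
- rewrite sumE => /esym /rowE; rewrite msize0 => /(_ isT) c0 j.
  have /row_free_inj/(_ (\row_j c (cast_ord (esym szbs) j)) 0) :=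
    maxrowsub_free M.
  rewrite -c0 mul0mx (_ : \row_l _ = 0); last first.
    by apply/rowP => l; rewrite !mxE mcoeff0.
  move=> /(_ erefl)/rowP/(_ (cast_ord szbs j)).
  by rewrite !mxE cast_ordK.
have /submxP[D kD] : (row k M <= rowsub h M)%MS.
  by rewrite (eq_maxrowsub M) row_sub.
exists (fun j => D 0 (cast_ord szbs j)); rewrite sumE; apply/rowE => //.
apply/rowP => l; move/rowP/(_ l): kD; rewrite !mxE => ->.
by apply: eq_bigr => j _; rewrite !mxE cast_ordKV.
Qed.

Lemma indep_le_spanning (J : R -> Prop) a b (C : 'I_a -> R) (B : 'I_b -> R) :
    (forall c p q, J p -> J q -> J (c *: p + q)) ->
    (forall c : 'I_a -> K, J (\sum_i c i *: C i) -> forall i, c i = 0) ->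
    (forall p, exists c : 'I_b -> K, J (p - \sum_j c j *: B j)) ->
  (a <= b)%N.
Proof.
move=> JP indep span; case: a => // a in C indep *.
have J0 : J 0.
  have [c Jc] := span 0.
  by have := JP (-1) _ _ Jc Jc; rewrite scaleN1r addNr.
have [X JX] := fin_all_exists (fun i => span (C i)).
pose M := \matrix_(i < a.+1, j < b) X i j.
suff /eqP <- : row_free M by exact: rank_leq_col.
apply: inj_row_free => v vM0; apply/rowP => i; rewrite mxE.
apply: (indep (fun i => v 0 i)).
(* Since [v *m M = 0], the subtracted [B]-parts cancel in total; what remains is a combination of
   elements of [J]. *)
have -> : \sum_i v 0 i *: C i = \sum_i v 0 i *: (C i - \sum_j X i j *: B j).
  under [RHS]eq_bigr do rewrite scalerBr.
  rewrite sumrB -[LHS]subr0; congr (_ - _); apply/esym.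
  under eq_bigr do rewrite scaler_sumr.
  rewrite exchange_big big1 // => j _.
  move/rowP/(_ j): vM0; rewrite !mxE => vj.
  under eq_bigr do rewrite scalerA.
  rewrite -scaler_suml [X in X *: _](_ : _ = 0) ?scale0r // -[RHS]vj.
  by apply: eq_bigr => l _; rewrite mxE.
by elim/big_rec: _ => // l p _; apply: JP.
Qed.

End Dimension.

(** * Degree bounds and linear spans *)

Section Degree.
Set Implicit Arguments.
Unset Strict Implicit.
Variables (K : fieldType) (n : nat).
Local Notation R := {mpoly K[n]}.
Implicit Types (p q : R).

Lemma degleP c p :
  reflect (forall m, m \in msupp p -> (mdeg m <= c)%N) (degle c p).
Proof.
rewrite /degle msizeE; apply: (iffP (bigmax_leqP_seq _ _ _ _)) => le m mp.
  exact: le.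
by move=> _; apply: le.
Qed.

Lemma degleM c c' p q : degle c p -> degle c' q -> degle (c + c') (p * q).
Proof.
move=> /degleP pc /degleP qc; apply/degleP => m.
move=> /msuppM_le/allpairsP[[m1 m2] /= [/pc le1 /qc le2 ->]].
by rewrite mdegD leq_add.
Qed.

Lemma inspan_degle c a (A : 'I_a -> R) p :
  (forall j, degle c (A j)) -> inspan A p -> degle c p.
Proof.
move=> Ac [x ->]; apply/degleP => m; rewrite mcoeff_msupp.
apply: contraR; rewrite -ltnNge => ltm; rewrite raddf_sum big1 // => j _.
rewrite /= mcoeffZ memN_msupp_eq0 ?mulr0 //; apply: contraL ltm.
by rewrite -leqNgt; apply/degleP.
Qed.

Lemma inspan_gen a (A : 'I_a -> R) j : inspan A (A j).
Proof.
exists (fun l => (l == j)%:R); rewrite (bigD1 j) //= eqxx scale1r big1 ?addr0 //.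
by move=> l /negPf ->; rewrite scale0r.
Qed.

Lemma inspan_sum a b (A : 'I_a -> R) (B : 'I_b -> R) (c : 'I_b -> K) :
  (forall j, inspan A (B j)) -> inspan A (\sum_j c j *: B j).
Proof.
move=> /fin_all_exists[X XP]; exists (fun l => \sum_j c j * X j l).
under eq_bigr => j _ do rewrite XP scaler_sumr.
rewrite exchange_big; apply: eq_bigr => l _; rewrite scaler_suml.
by apply: eq_bigr => j _; rewrite scalerA.
Qed.

Lemma inspanB a (A : 'I_a -> R) p q :
  inspan A p -> inspan A q -> inspan A (p - q).
Proof.
move=> [x ->] [y ->]; exists (fun j => x j - y j); rewrite -sumrB.
by apply: eq_bigr => j _; rewrite scalerBl.
Qed.

End Degree.

(** * The bilinear form [ph (p * q)] on the quotient by its radical *)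

Section Gorenstein.
Set Implicit Arguments.
Unset Strict Implicit.
Variables (K : fieldType) (n : nat).
Local Notation R := {mpoly K[n]}.
Implicit Types (p q : R).
Variable ph : R -> K.
Hypothesis phP : forall c p q, ph (c *: p + q) = c * ph p + ph q.

(** The counterpart of [hankel] for [ph], free of degree restrictions. *)
Definition gram a b (Q : 'I_a -> R) (P : 'I_b -> R) : 'M[K]_(a, b) :=
  \matrix_(i < a, j < b) ph (Q i * P j).

Lemma scalar_form0 (L : R -> K) :
  (forall c p q, L (c *: p + q) = c * L p + L q) -> L 0 = 0.
Proof.
by move=> LP; have := LP (-1) 0 0; rewrite scaler0 addr0 mulN1r addNr.
Qed.

Lemma scalar_form_sum (L : R -> K) r (c : 'I_r -> K) (B : 'I_r -> R) :
    (forall c p q, L (c *: p + q) = c * L p + L q) ->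
  L (\sum_j c j *: B j) = \sum_j c j * L (B j).
Proof.
move=> LP; elim/big_rec2: _ => [|j x y _ IH]; first exact: scalar_form0.
by rewrite LP IH.
Qed.

Lemma ph_mulP p c q1 q2 : ph (p * (c *: q1 + q2)) = c * ph (p * q1) + ph (p * q2).
Proof. by rewrite mulrDr -scalerAr phP. Qed.

Lemma annih_mull p q : annih ph p -> annih ph (q * p).
Proof. by move=> p0 g; rewrite mulrAC mulrC p0. Qed.

Lemma annih_linear c p q : annih ph p -> annih ph q -> annih ph (c *: p + q).
Proof. by move=> p0 q0 g; rewrite mulrC ph_mulP ![g * _]mulrC p0 q0 mulr0 addr0. Qed.

Lemma annih0 : annih ph 0.
Proof. by move=> g; rewrite mul0r (scalar_form0 phP). Qed.

Variables (r : nat) (B B' : 'I_r -> R).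
Hypotheses (Bbasis : quot_basis ph B) (B'basis : quot_basis ph B').

(** Such a functional factors through the quotient, where [B'] spans. *)
Lemma quot_ext (L : R -> K) :
    (forall c p q, L (c *: p + q) = c * L p + L q) ->
    (forall p, annih ph p -> L p = 0) -> (forall j, L (B' j) = 0) ->
  forall p, L p = 0.
Proof.
move=> LP L0 LB p; have [c /L0] := B'basis.2 p.
rewrite -scaleN1r addrC LP scalar_form_sum // big1 => [|j _]; last by rewrite LB mulr0.
by rewrite mulr0 add0r.
Qed.

Lemma annih_of_basis p : (forall j, ph (B' j * p) = 0) -> annih ph p.
Proof.
move=> pB; apply: quot_ext => [c q1 q2|q q0|j].
- exact: ph_mulP.
- by rewrite mulrC q0.
- by rewrite mulrC pB.
Qed.

Lemma gram_mul a b (Q : 'I_a -> R) (P : 'I_b -> R) (c : 'cV[K]_b) i :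
  (gram Q P *m c) i 0 = ph (Q i * \sum_j c j 0 *: P j).
Proof.
rewrite (scalar_form_sum _ _ (ph_mulP (Q i))) mxE.
by apply: eq_bigr => j _; rewrite mxE mulrC.
Qed.

(** A kernel vector gives a combination of [B] orthogonal to [B'], hence in the annihilator, hence
    with zero coefficients. *)
Lemma gram_unit : gram B' B \in unitmx.
Proof.
rewrite -unitmx_tr -row_free_unit; apply: inj_row_free => v v0.
have {}v0 : gram B' B *m v^T = 0 by rewrite -[LHS]trmxK trmx_mul trmxK v0 trmx0.
apply/rowP => j; rewrite mxE.
apply: (Bbasis.1 (fun j => v 0 j)); apply: annih_of_basis => i.
move/colP/(_ i): v0; rewrite gram_mul mxE => <-; congr (ph (_ * _)).
by apply: eq_bigr => l _; rewrite mxE.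
Qed.

Lemma gram_coord p :
  let c := invmx (gram B' B) *m \col_i ph (B' i * p) in
  annih ph (p - \sum_j c j 0 *: B j).
Proof.
move=> c; apply: annih_of_basis => i; rewrite addrC -scaleN1r ph_mulP.
by rewrite -gram_mul mulKVmx ?gram_unit // mxE mulN1r addNr.
Qed.

(** Gorenstein duality: [ph] generates the dual of the quotient. The representing element solves the
    invertible Gram system, and agreement on [B'] suffices. *)
Lemma gram_dual (psi : R -> K) :
    (forall c p q, psi (c *: p + q) = c * psi p + psi q) ->
    (forall p, annih ph p -> psi p = 0) ->
  exists c : 'I_r -> K, forall q, psi q = ph ((\sum_j c j *: B j) * q).
Proof.
move=> psiP psi0; pose c := invmx (gram B' B) *m \col_i psi (B' i).
exists (fun j => c j 0) => q; apply/eqP; rewrite -subr_eq0; apply/eqP.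
move: q; apply: quot_ext => [x q1 q2|q q0|j].
- by rewrite psiP ph_mulP; ring.
- by rewrite psi0 // mulrC q0 subrr.
- by rewrite mulrC -gram_mul mulKVmx ?gram_unit // mxE subrr.
Qed.

Lemma rank_gram a a' (A : 'I_a -> R) (A' : 'I_a' -> R) :
    (forall j, inspan A (B j)) -> (forall j, inspan A' (B' j)) ->
  \rank (gram A' A) = r.
Proof.
move=> /fin_all_exists[E EP] /fin_all_exists[E' EP'].
apply/eqP; rewrite eqn_leq; apply/andP; split.
  (* Reducing [A'] to [B'] modulo the annihilator changes no entry, so the matrix factors through
     dimension [r]. *)
  have [X XP] := fin_all_exists (fun j => B'basis.2 (A' j)).
  suff -> : gram A' A = (\matrix_(i, l) X i l) *m gram B' A.
    exact: leq_trans (mxrankM_maxl _ _) (rank_leq_col _).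
  apply/matrixP => i j; rewrite !mxE.
  have := XP i (A j); rewrite mulrC addrC -scaleN1r ph_mulP mulN1r.
  rewrite (scalar_form_sum _ _ (ph_mulP (A j))) => /eqP; rewrite addrC subr_eq0 mulrC.
  by move/eqP->; apply: eq_bigr => l _; rewrite !mxE [A j * _]mulrC.
(* Conversely, the coordinates of [B] in [A] and of [B'] in [A'] make the invertible matrix a
   product containing [gram A' A]. *)
have <- : \rank (gram B' B) = r by rewrite mxrank_unit // gram_unit.
suff -> : gram B' B = (\matrix_(i, l) E' i l) *m gram A' A *m (\matrix_(l, j) E j l).
  exact: leq_trans (mxrankM_maxl _ _) (mxrankM_maxr _ _).
apply/matrixP => i j; rewrite !mxE EP (scalar_form_sum _ _ (ph_mulP (B' i))).
apply: eq_bigr => l _; rewrite !mxE mulrC; congr (_ * _).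
rewrite EP' mulrC (scalar_form_sum _ _ (ph_mulP (A l))).
by apply: eq_bigr => k _; rewrite !mxE [A l * _]mulrC.
Qed.

End Gorenstein.

(** * Separation of the points and decomposition of the quotient into local pieces *)

Section Separation.
Set Implicit Arguments.
Unset Strict Implicit.
Variables (K : fieldType) (n : nat).
Local Notation R := {mpoly K[n]}.
Implicit Types (p q g : R).

Lemma separate_two (xi eta : 'I_n -> K) t N : xi t != eta t ->
  exists e : R, forall q, (msize q <= N)%N ->
    diffop (shift xi e) q = q /\ diffop (shift eta e) q = 0.
Proof.
move=> ne; pose c := xi t - eta t; have c0 : c != 0 by rewrite subr_eq0.
pose y : R := c^-1 *: ('X_t - (eta t)%:MP).
(* [y] is 1 at [xi] and 0 at [eta]; the polynomial below is divisible by
   [y ^+ N], and its difference to 1 is divisible by [(y - 1) ^+ N]. *)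
exists (1 - (1 - y ^+ N) ^+ N) => q leq_qN.
(* The degree of [q] is below [N], so it suffices to exhibit a factor ['X_t ^+ N] after each
   translation: from [y - 1] at [xi], from [y] at [eta]. *)
have annih u : diffop (u * 'X_t ^+ N) q = 0.
  by rewrite diffopM diffop_Xn_eq0 // diffop0r.
have yxi : shift xi y = 1 + c^-1 *: 'X_t.
  rewrite shiftZ rmorphB /= shiftXU shiftC -addrA -mpolyCB -/c scalerDr.
  by rewrite addrC -mul_mpolyC -mpolyCM mulVf.
have yeta : shift eta y = c^-1 *: 'X_t.
  by rewrite shiftZ rmorphB /= shiftXU shiftC addrK.
rewrite !(rmorphB, rmorphXn, rmorph1) /= yxi yeta; split; last first.
  have -> : 1 - (1 - (c^-1 *: 'X_t) ^+ N) ^+ N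
      = - (\sum_(i < N) (1 - (c^-1 *: 'X_t) ^+ N) ^+ i) * - (c^-1 ^+ N)%:MP * 'X_t ^+ N :> R.
    rewrite -opprB subrX1 addrAC subrr add0r exprZn -mul_mpolyC.
    by rewrite mulNr mulrN opprK; ring.
  by [].
have -> : (1 - (1 + c^-1 *: 'X_t) ^+ N) ^+ N
   = ((- c^-1) *: (\sum_(i < N) (1 + c^-1 *: 'X_t) ^+ i)) ^+ N * 'X_t ^+ N :> R.
  rewrite -exprMn; congr (_ ^+ N); rewrite -opprB subrX1 addrAC subrr add0r.
  by rewrite scaleNr mulNr -scalerAl -scalerAl mulrC.
by rewrite diffopB diffop1 annih subr0.
Qed.

Variables (s : nat) (qs : 'I_s -> R) (xi : 'I_s -> 'I_n -> K).
Hypothesis charK : [pchar K] =i pred0.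
Hypothesis xi_neq : forall i j, i != j -> exists t, xi i t != xi j t.

(** Take the product over j of the two-point separators of i from j: at i every factor acts as the
    identity, at j the factor for j kills [qs j]. *)
Lemma separators : exists e : 'I_s -> R, forall i j p,
  diffop (shift (xi j) (p * e i)) (qs j) =
  if i == j then diffop (shift (xi j) p) (qs j) else 0.
Proof.
pose N := (\max_(j < s) msize (qs j))%N.
have leN j : (msize (qs j) <= N)%N by exact: (leq_bigmax j).
have E i j : exists e : R, i != j ->
    diffop (shift (xi i) e) (qs i) = qs i /\ diffop (shift (xi j) e) (qs j) = 0.
  have [->|/xi_neq[t /(separate_two N)[e eP]]] := eqVneq i j; first by exists 0.
  by exists e => _; split; [have [] := eP _ (leN i) | have [] := eP _ (leN j)].
have [e eP] := fin_all_exists (fun i => fin_all_exists (E i)).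
exists (fun i => \prod_(j | i != j) e i j) => i j p.
rewrite rmorphM diffopM; case: ifPn => [/eqP <-|ij].
  congr (diffop _ _).
  apply: (big_ind (fun x => diffop (shift (xi i) x) (qs i) = qs i))
    => [|x y Hx Hy|l il].
  - by rewrite rmorph1 diffop1.
  - by rewrite rmorphM diffopM Hy.
  - by have [] := eP i l il.
rewrite (bigD1 j) //= mulrC rmorphM diffopM.
by have [_ ->] := eP i j ij; rewrite !diffop0r.
Qed.

(** For the forward direction, pairing [p] with a separator times a back-translated arbitrary [g]
    isolates the constant term of [g] acting on the i-th component; nondegeneracy of the apolar
    pairing concludes. *)
Lemma annihP p :
  annih (phi qs xi) p <-> forall i, diffop (shift (xi i) p) (qs i) = 0.
Proof.
split=> [p0 i|p0 q]; last first.
  rewrite phiE // big1 // => i _.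
  by rewrite mulrC rmorphM diffopM p0 diffop0r mcoeff0.
have [e eP] := separators; apply: diffop_nondeg => // g.
have := p0 (shift (fun j => - xi i j) g * e i); rewrite phiE // (bigD1 i) //=.
rewrite mulrA eP eqxx rmorphM /= shiftK mulrC diffopM big1 ?addr0 // => j ji.
by rewrite eP eq_sym (negPf ji) mcoeff0.
Qed.

Lemma diffop_surj (g : 'I_s -> R) :
  exists p, forall i, diffop (shift (xi i) p) (qs i) = diffop (g i) (qs i).
Proof.
have [e eP] := separators.
exists (\sum_i shift (fun j => - xi i j) (g i) * e i) => i.
rewrite raddf_sum diffopE linear_sum -/(diffop _ _) (bigD1 i) //= -diffopE.
rewrite eP eqxx shiftK big1 ?addr0 // => j ji.
by rewrite -diffopE eP (negPf ji).
Qed.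

(** Acting on all [qs i] at once maps [R] to the direct sum of the derivative spaces, with kernel
    the annihilator by [annihP] and surjectively by [diffop_surj]. Lifting bases of the summands
    gives a second basis of the quotient, to be counted against [B]. *)
Lemma quot_dimension r (B : 'I_r -> R) : quot_basis (phi qs xi) B ->
  exists bs : 'I_s -> seq R,
    (forall i, is_basis_of (deriv_span (qs i)) (bs i)) /\
    r = (\sum_(i < s) size (bs i))%N.
Proof.
move=> [Bindep Bspan].
have /fin_all_exists[bs bsP] i : exists bs, is_basis_of (deriv_span (qs i)) bs.
  (* As [B] spans modulo the annihilator, its images generate the derivative space, which is thus
     finite-dimensional. *)
  have [bs [bs_in bs_indep bs_span]] :=
    basis_of_family (fun j => diffop (shift (xi i) (B j)) (qs i)).
  exists bs; split=> [j|]; first by have [k ->] := bs_in j; exists (shift (xi i) (B k)).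
  split=> // v [g ->]; have [c /annihP/(_ i)] := Bspan (shift (fun j => - xi i j) g).
  rewrite rmorphB /= shiftK shift_sum diffopB diffop_sum => /eqP.
  rewrite subr_eq0 => /eqP ->.
  have [X XP] := fin_all_exists bs_span.
  exists (fun l => \sum_j c j * X j l).
  under [LHS]eq_bigr => j _ do rewrite XP scaler_sumr.
  rewrite exchange_big; apply: eq_bigr => l _; rewrite scaler_suml.
  by apply: eq_bigr => j _; rewrite scalerA.
exists bs; split=> //.
pose I : finType := {i : 'I_s & 'I_(size (bs i))}.
(* [C u] lifts one basis vector placed in the component [tag u], with zero in the others. *)
have /fin_all_exists[C CP] (u : I) : exists p, forall j,
    diffop (shift (xi j) p) (qs j) = if tag u == j then (bs (tag u))`_(tagged u) else 0.
  have [g gP] := (bsP (tag u)).1 (tagged u).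
  have [p pP] := diffop_surj (fun j => if tag u == j then g else 0).
  exists p => j; rewrite pP gP; case: eqP => [<-//|_]; exact: diffop0.
have sumC (c : I -> K) j : diffop (shift (xi j) (\sum_u c u *: C u)) (qs j) =
    \sum_(l < size (bs j)) c (Tagged _ l) *: (bs j)`_l.
  rewrite shift_sum diffop_sum.
  have -> : \sum_u c u *: diffop (shift (xi j) (C u)) (qs j) =
    \sum_(u : I) c (Tagged _ (tagged u))
       *: (if tag u == j then (bs (tag u))`_(tagged u) else 0).
    by apply: eq_bigr => -[i l] _; rewrite CP.
  rewrite -(sig_big_dep (fun=> true) (fun _ _ => true) (fun i (l : 'I_(size (bs i))) =>
     c (Tagged _ l) *: (if i == j then (bs i)`_l else 0))) /=.
  rewrite (bigD1 j) //= [X in _ + X]big1 => [|i ij].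
    by rewrite addr0; apply: eq_bigr => l _; rewrite eqxx.
  by rewrite big1 // => l _; rewrite (negPf ij) scaler0.
have Cindep (c : I -> K) : annih (phi qs xi) (\sum_u c u *: C u) -> forall u, c u = 0.
  move=> /annihP c0 [i l]; move: (c0 i); rewrite sumC.
  by move/((bsP i).2.1 (fun l => c (Tagged _ l)))/(_ l).
have Cspan p : exists c : I -> K, annih (phi qs xi) (p - \sum_u c u *: C u).
  have /fin_all_exists[c cP] i : exists c : 'I_(size (bs i)) -> K,
      diffop (shift (xi i) p) (qs i) = \sum_l c l *: (bs i)`_l.
    by apply: (bsP i).2.2; exists (shift (xi i) p).
  exists (fun u => c (tag u) (tagged u)); apply/annihP => i.
  by rewrite rmorphB /= diffopB sumC cP subrr.
have -> : (\sum_(i < s) size (bs i))%N = #|{: I}|.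
  rewrite card_tagged sumnE big_map big_enum /=.
  by apply: eq_bigr => i _; rewrite card_ord.
pose C' (l : 'I_#|{: I}|) := C (enum_val l).
have sumC' (c : I -> K) : \sum_l c (enum_val l) *: C' l = \sum_u c u *: C u.
  by rewrite [RHS](reindex _ (onW_bij _ (@enum_val_bij I))).
apply/eqP; rewrite eqn_leq; apply/andP; split.
  apply: (@indep_le_spanning _ _ (annih (phi qs xi)) _ _ B C') => //.
    by move=> c; apply/annih_linear/phiP.
  move=> p; have [c cP] := Cspan p; exists (fun l => c (enum_val l)).
  by rewrite sumC'.
apply: (@indep_le_spanning _ _ (annih (phi qs xi)) _ _ C' B) => //.
  by move=> c; apply/annih_linear/phiP.
move=> c c0 l.
have := Cindep (fun u => c (enum_rank u)) _ (enum_val l); rewrite enum_valK.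
apply; rewrite -sumC'; congr (annih _ _): c0.
by apply: eq_bigr => k _; rewrite enum_valK.
Qed.

End Separation.

(** * Generated ideals and reduction to a finite family *)

Section GeneratedIdeal.
Set Implicit Arguments.
Unset Strict Implicit.
Variables (K : fieldType) (n : nat) (P : {mpoly K[n]} -> Prop).
Local Notation R := {mpoly K[n]}.
Implicit Types (p q : R).

Definition genideal p := exists (m : nat) (g v : 'I_m -> R),
  (forall l, P (v l)) /\ p = \sum_(l < m) g l * v l.

Lemma genideal0 : genideal 0.
Proof. by exists 0%N, (fun=> 0), (fun=> 0); split=> [[]//|]; rewrite big_ord0. Qed.

Lemma genideal_gen p : P p -> genideal p.
Proof.
by move=> Pp; exists 1%N, (fun=> 1), (fun=> p); rewrite big_ord1 mul1r.
Qed.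

Lemma genidealD p q : genideal p -> genideal q -> genideal (p + q).
Proof.
move=> [m1 [g1 [v1 [P1 ->]]]] [m2 [g2 [v2 [P2 ->]]]].
pose pick T (x1 : 'I_m1 -> T) (x2 : 'I_m2 -> T) l :=
  match split l with inl i => x1 i | inr i => x2 i end.
exists (m1 + m2)%N, (pick R g1 g2), (pick R v1 v2); split=> [l|].
  by rewrite /pick; case: split.
rewrite big_split_ord /pick; congr (_ + _); apply: eq_bigr => i _.
  by rewrite (unsplitK (inl i)).
by rewrite (unsplitK (inr i)).
Qed.

Lemma genidealM p q : genideal q -> genideal (p * q).
Proof.
move=> [m [g [v [Pv ->]]]]; exists m, (fun l => p * g l), v; split=> //.
by rewrite mulr_sumr; apply: eq_bigr => l _; rewrite mulrA.
Qed.

Lemma genidealZ c q : genideal q -> genideal (c *: q).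
Proof. by rewrite -mul_mpolyC; apply: genidealM. Qed.

Variables (r : nat) (B : 'I_r -> R).
Hypothesis B1 : exists j, B j = 1.
Hypothesis BX : forall i j, exists c : 'I_r -> K,
  genideal ('X_i * B j - \sum_l c l *: B l).

(** The polynomials reducible to combinations of [B] form a subspace containing 1 and stable under
    each variable, hence contain all monomials. *)
Lemma genideal_reduction p : exists c : 'I_r -> K,
  genideal (p - \sum_l c l *: B l).
Proof.
pose D p := exists c : 'I_r -> K, genideal (p - \sum_l c l *: B l).
have DP a p1 p2 : D p1 -> D p2 -> D (a *: p1 + p2).
  move=> [c1 G1] [c2 G2]; exists (fun l => a * c1 l + c2 l).
  have -> : a *: p1 + p2 - \sum_l (a * c1 l + c2 l) *: B l =
      a *: (p1 - \sum_l c1 l *: B l) + (p2 - \sum_l c2 l *: B l).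
    under eq_bigr do rewrite scalerDl -scalerA.
    by rewrite big_split /= -scaler_sumr scalerBr opprD addrACA.
  by apply: genidealD => //; apply: genidealZ.
have DG q : genideal q -> D q.
  move=> Gq; exists (fun=> 0); rewrite big1 ?subr0 // => l _; exact: scale0r.
have DX i q : D q -> D ('X_i * q).
  move=> [c Gq]; rewrite -[q](subrK (\sum_l c l *: B l)) mulrDr.
  rewrite -[X in X + _]scale1r; apply: (DP); first exact/DG/genidealM.
  rewrite mulr_sumr; elim/big_rec: _ => [|l x _ Dx]; first exact/DG/genideal0.
  by rewrite -scalerAr; apply: (DP) => //; apply: BX.
elim/mpolyind: p => [|c m p _ _ Dp]; first exact/DG/genideal0.
apply: (DP) => {p Dp}//; elim/mnm_ind: m => [|i m Dm]; last first.
  by rewrite mpolyXD; apply: DX.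
have [j Bj] := B1; exists (fun l => (l == j)%:R).
rewrite (bigD1 j) //= eqxx scale1r big1 ?addr0 ?Bj ?mpolyX0 ?subrr.
  exact: genideal0.
by move=> l /negPf ->; rewrite scale0r.
Qed.

End GeneratedIdeal.

(** * Hankel matrices of [f] in bounded degree and the quotient by the annihilator *)

Theorem theorem4p12 (K : fieldType) (n d s : nat)
  (charK : [pchar K] =i pred0)
  (f : {mpoly K[n.+1]}) (om : 'I_s -> {mpoly K[n.+1]}) (k : 'I_s -> nat)
  (xi : 'I_s -> 'I_n -> K)
  (f_hom : f \is d.-homog)
  (k_le : forall i, (k i <= d)%N)
  (om_hom : forall i, om i \is (k i).-homog)
  (ell_nprop : forall i j, i != j ->
     ~ exists c : K, linform (xi i) = c *: linform (xi j))
  (ell_ndiv : forall i, ~ exists g, om i = linform (xi i) * g)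
  (f_gad : f = \sum_(i < s) om i * linform (xi i) ^+ (d - k i))
  (w : 'I_s -> nat -> {mpoly K[n]})
  (w_hom : forall i j, (j <= k i)%N -> w i j \is j.-homog)
  (w_dec : forall i, om i =
     \sum_(j < (k i).+1) liftR (w i j) * linform (xi i) ^+ (k i - j)) :
  let omd := fun i => omega_dehom d (w i) (k i) in
  let ph := phi omd xi in
  forall (r : nat) (B B' : 'I_r -> {mpoly K[n]}),
  quot_basis ph B -> quot_basis ph B' -> (exists j, B j = 1) ->
  forall (c a a' : nat) (A : 'I_a -> {mpoly K[n]}) (A' : 'I_a' -> {mpoly K[n]}),
  (c <= d)%N ->
  (forall j, degle c (A j)) -> (forall j, degle (d - c) (A' j)) ->
  linindep A -> linindep A' ->
  (forall j, inspan A (B j)) -> (forall i j, inspan A ('X_i * B j)) ->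
  (forall j, inspan A' (B' j)) ->
  let H := hankel d f A' A in
  let H0 := hankel d f B' B in
  (* (1) *) H0 \in unitmx /\
      (* (2) *) \rank H = r /\
        (exists bs : 'I_s -> seq {mpoly K[n]},
           (forall i, is_basis_of (deriv_span (omd i)) (bs i)) /\
           r = (\sum_(i < s) size (bs i))%N) /\
      (* (3) *) (forall i : 'I_n,
        let M := invmx H0 *m hankel d f B' (fun j => 'X_i * B j) in
        forall j, annih ph ('X_i * B j - \sum_(l < r) M l j *: B l)) /\
      (* (4a) *) (forall p, hker d f A A' p <-> inspan A p /\ annih ph p) /\
      (* (4b) *) (forall p, annih ph p <->
          exists (m : nat) (g v : 'I_m -> {mpoly K[n]}),
            (forall l, hker d f A A' (v l)) /\ p = \sum_(l < m) g l * v l) /\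
      (* (4c) *) (forall lam : {mpoly K[n]} -> K,
        (exists p, inspan A p /\
           forall q, inspan A' q -> lam q = fcheck d f (p * q)) <->
        (exists psi : {mpoly K[n]} -> K,
           (forall (x : K) (p q : {mpoly K[n]}), psi (x *: p + q) = x * psi p + psi q)
           /\ (forall p, annih ph p -> psi p = 0)
           /\ forall q, inspan A' q -> lam q = psi q)).
Proof.
move=> omd ph r B B' Bbasis B'basis B1 c a a' A A' lecd degA degA' _ _ AB AXB AB'.
move=> H H0.
have phP x (p q : {mpoly K[n]}) : ph (x *: p + q) = x * ph p + ph q by exact: phiP.
(* The bounds c and d - c keep the product within degree [d], where [fcheck] and [ph] agree. *)
have fE p q : inspan A p -> inspan A' q -> fcheck d f (p * q) = ph (p * q).
  move=> /(inspan_degle degA) degp /(inspan_degle degA') degq.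
  rewrite f_gad; apply: fcheck_phi => //.
  by rewrite -(subnKC lecd); apply: degleM.
have fE' p q : inspan A p -> inspan A' q -> fcheck d f (q * p) = ph (q * p).
  by rewrite mulrC; apply: fE.
have xi_neq i j : i != j -> exists t, xi i t != xi j t.
  (* Equal points would make the two linear forms equal, hence proportional with factor 1. *)
  move=> ij; apply/existsP; apply: contraPT (ell_nprop i j ij).
  rewrite negb_exists => /forallP eqxi; apply; exists 1.
  rewrite scale1r /linform; congr (_ + _); apply: eq_bigr => t _.
  by have := eqxi t; rewrite negbK => /eqP ->.
have H0E : H0 = gram ph B' B by apply/matrixP => i j; rewrite !mxE fE'.
have HE : H = gram ph A' A.
  by apply/matrixP => i j; rewrite !mxE fE' //; apply: inspan_gen.
have coordX i j : annih ph ('X_i * B j - \sum_(l < r)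
    (invmx H0 *m hankel d f B' (fun j => 'X_i * B j)) l j *: B l).
  rewrite H0E; have := gram_coord phP Bbasis B'basis ('X_i * B j).
  congr (annih ph (_ - _)); apply: eq_bigr => l _; congr (_ *: _).
  by rewrite !mxE; apply: eq_bigr => u _; rewrite !mxE fE'.
have kerE p : hker d f A A' p <-> inspan A p /\ annih ph p.
  split=> -[Ap p0]; split=> //; last by move=> q A'q; rewrite fE // p0.
  by apply: (annih_of_basis phP B'basis) => j; rewrite mulrC -fE // p0.
split; first by rewrite H0E gram_unit.
split; first by rewrite HE (rank_gram phP Bbasis B'basis).
split; first exact: (quot_dimension charK xi_neq Bbasis).
split; first by move=> i M j; apply: coordX.
split; first exact: kerE.
have genE p : genideal (hker d f A A') p -> annih ph p.
  move=> [m [g [v [vker ->]]]]; elim/big_rec: _ => [|l x _ x0].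
    exact: annih0.
  rewrite -[g l * _]scale1r; apply: annih_linear => //; apply: annih_mull.
  by have /kerE[] := vker l.
split=> [p|lam].
  split; last exact: genE.
  move=> p0; suff : genideal (hker d f A A') p by [].
  (* The multiplication relations for ['X_i * B j] lie in the span of [A] and in the annihilator, so
     they belong to the kernel and can drive the reduction. *)
  have [|y Gy] := genideal_reduction (P := hker d f A A') B1 _ p.
    move=> i j; exists (fun l =>
      (invmx H0 *m hankel d f B' (fun j => 'X_i * B j)) l j).
    apply/genideal_gen/kerE; split; last exact: coordX.
    by apply: inspanB => //; apply: inspan_sum.
  (* The remainder is a difference of two elements of the annihilator, so independence of [B] makes
     it vanish and [p] itself is in the ideal. *)
  suff y0 l : y l = 0.
    by move: Gy; rewrite big1 ?subr0 // => l _; rewrite y0 scale0r.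
  apply: Bbasis.1 l; rewrite -[X in annih _ X](subKr p) -[_ - _]addrC -scaleN1r.
  by apply: annih_linear => //; apply: genE.
split=> [[p [Ap lamE]]|[psi [psiP [psi0 lamE]]]].
  exists (fun q => ph (p * q)); split; first by move=> x q1 q2; apply: ph_mulP.
  split=> [q q0|q A'q]; first by rewrite mulrC q0.
  by rewrite lamE // fE.
(* Duality represents [psi] by an element of the span of [B], which lies in the span of [A]. *)
have [y yP] := gram_dual phP Bbasis B'basis psiP psi0.
have Ay : inspan A (\sum_j y j *: B j) by apply: inspan_sum.
by exists (\sum_j y j *: B j); split=> // q A'q; rewrite lamE // yP fE.
Qed.
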